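(* Let $B$ be a Rota-Baxter operator on a commutative Hopf heap $(C,\Delta,[-,-,-])$. For any $x\in G(C)$, if $B(x)=x$, then $B$ is a Rota-Baxter co-operator on the Hopf algebra $H_x(C)$, whose multiplication and antipode are $ab=[a,x,b]$ and $S(a)=[x,a,x]$.
   Context: Everything is over a fixed field $\mathbf{k}$. Sweedler notation $\Delta(c)=c_1\otimes c_2$ (iterated: $c_1\otimes c_2\otimes c_3\otimes c_4$) is used; $C^{cop}$ is the co-opposite coalgebra; $G(C)$ is the set of group-like elements of a coalgebra $C$. A Hopf heap is a coalgebra $C$ with a coalgebra map $C\otimes C^{cop}\otimes C\to C$, $a\otimes b\otimes c\mapsto[a,b,c]$, such that $[[a,b,c],d,h]=[a,b,[c,d,h]]$ and $[c_1,c_2,a]=[a,c_1,c_2]=\varepsilon(c)a$ for all $a,b,c,d,h\in C$. It is commutative if $[x,y,z]=[z,y,x]$ for all $x,y,z$. For $x\in G(C)$, $H_x(C)$ is the Hopf algebra on the coalgebra $C$ with unit $x$, multiplication $ab=[a,x,b]$, antipode $S(a)=[x,a,x]$. A Rota-Baxter operator on a Hopf heap $C$ is a linear map $B:C\to C$ with $B([a,b,c])=[B(a),B(b),B(c)]$ and $B(a_1)\otimes B(a_2)=[B(a)_1,B(B(a)_4),B(B(a)_2)]\otimes B(a)_3$ for all $a,b,c\in C$. A Rota-Baxter co-operator on a commutative Hopf algebra $H$ with antipode $S$ is a (unital) algebra map $B:H\to H$ with $B(a_1)\otimes B(a_2)=B(a)_1B(B(a)_2S(B(a)_4))\otimes B(a)_3$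 for all $a\in H$. *)

(* Defs.v *)
From HB Require Import structures.
From mathcomp Require Import all_boot all_order all_algebra.
From mathcomp Require Import boolp.

Set Implicit Arguments.
Unset Strict Implicit.
Unset Printing Implicit Defensive.

Import GRing.Theory.
Local Open Scope ring_scope.
Local Open Scope quotient_scope.

(* Tensor products of vector spaces: formal finite sums of pairs (u, v),     *)
(* modulo the congruence generated by bilinearity. Coefficients are absorbed *)
(* in the first components.                                                  *)

Section TensorDef.
Variables (k : fieldType) (U V : lmodType k).

Implicit Types s t : seq (U * V).

Inductive tensor_eq : seq (U * V) -> seq (U * V) -> Prop :=
| tensor_eq_refl s : tensor_eq s s
| tensor_eq_sym s t : tensor_eq s t -> tensor_eq t s
| tensor_eq_trans s t r : tensor_eq s t -> tensor_eq t r -> tensor_eq s r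
| tensor_eq_cat s s' t t' :
    tensor_eq s s' -> tensor_eq t t' -> tensor_eq (s ++ t) (s' ++ t')
| tensor_eq_catC s t : tensor_eq (s ++ t) (t ++ s)
| tensor_eq_Dl u u' v : tensor_eq [:: (u + u', v)] [:: (u, v); (u', v)]
| tensor_eq_Dr u v v' : tensor_eq [:: (u, v + v')] [:: (u, v); (u, v')]
| tensor_eq_Z a u v : tensor_eq [:: (a *: u, v)] [:: (u, a *: v)]
| tensor_eq_0 v : tensor_eq [:: (0, v)] [::].

Definition tensor_eqb : rel (seq (U * V)) := fun s t => `[< tensor_eq s t >].

Lemma tensor_eqb_refl : reflexive tensor_eqb.
Proof. by move=> s; apply/asboolP; constructor. Qed.

Lemma tensor_eqb_sym : symmetric tensor_eqb.
Proof. by move=> s t; apply/asboolP/asboolP; apply: tensor_eq_sym. Qed.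

Lemma tensor_eqb_trans : transitive tensor_eqb.
Proof.
move=> t s r /asboolP st /asboolP tr; apply/asboolP.
exact: tensor_eq_trans st tr.
Qed.

Canonical tensor_equiv :=
  EquivRel tensor_eqb tensor_eqb_refl tensor_eqb_sym tensor_eqb_trans.

Definition tensor : Type := {eq_quot tensor_equiv}.
HB.instance Definition _ := Choice.on tensor.

Implicit Types x y z : tensor.

Definition tclass s : tensor := \pi_{eq_quot tensor_equiv} s.
Definition trepr x : seq (U * V) := repr (x : {eq_quot tensor_equiv}).

Lemma treprK x : tclass (trepr x) = x.
Proof. exact: reprK. Qed.

Lemma tclass_eq s t : tensor_eq s t <-> tclass s = tclass t.
Proof.
split=> [st|st]; first by apply/eqmodP/asboolP.
by apply/asboolP; move/eqmodP: st.
Qed.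

Lemma trepr_class s : tensor_eq (trepr (tclass s)) s.
Proof. by apply/tclass_eq; rewrite treprK. Qed.

Definition tensor_scale_seq (a : k) s := [seq (a *: p.1, p.2) | p <- s].

Definition tensor_zero := tclass [::].
Definition tensor_add x y := tclass (trepr x ++ trepr y).
Definition tensor_scale a x := tclass (tensor_scale_seq a (trepr x)).
Definition tensor_opp x := tensor_scale (-1) x.

Lemma tensor_addE s t :
  tensor_add (tclass s) (tclass t) = tclass (s ++ t).
Proof. by apply/tclass_eq/tensor_eq_cat; apply: trepr_class. Qed.

Lemma tensor_scale_seq_eq a s t :
  tensor_eq s t -> tensor_eq (tensor_scale_seq a s) (tensor_scale_seq a t).
Proof.
elim=> {s t} [s|s t _|s t r _ IH1 _|s s' t t' _ IH1 _ IH2|s t|u u' v|u v v'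
  |b u v|v] /=.
- exact: tensor_eq_refl.
- exact: tensor_eq_sym.
- exact: tensor_eq_trans.
- by rewrite /tensor_scale_seq !map_cat; apply: tensor_eq_cat.
- by rewrite /tensor_scale_seq !map_cat; apply: tensor_eq_catC.
- by rewrite scalerDr; apply: tensor_eq_Dl.
- exact: tensor_eq_Dr.
- by rewrite scalerA mulrC -scalerA; apply: tensor_eq_Z.
- by rewrite scaler0; apply: tensor_eq_0.
Qed.

Lemma tensor_scaleE a s :
  tensor_scale a (tclass s) = tclass (tensor_scale_seq a s).
Proof. by apply/tclass_eq/tensor_scale_seq_eq/trepr_class. Qed.

Lemma tensor_addA : associative tensor_add.
Proof.
move=> x y z; rewrite -(treprK x) -(treprK y) -(treprK z).
by rewrite !tensor_addE catA.
Qed.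

Lemma tensor_addC : commutative tensor_add.
Proof.
move=> x y; rewrite -(treprK x) -(treprK y) !tensor_addE.
exact/tclass_eq/tensor_eq_catC.
Qed.

Lemma tensor_add0 : left_id tensor_zero tensor_add.
Proof. by move=> x; rewrite -(treprK x) tensor_addE. Qed.

Lemma tensor_scale_seqDl a b s :
  tensor_eq (tensor_scale_seq (a + b) s)
            (tensor_scale_seq a s ++ tensor_scale_seq b s).
Proof.
apply/tclass_eq; elim: s => [//|[u v] s IH].
rewrite -[LHS]/(tclass ([:: ((a + b) *: u, v)] ++ tensor_scale_seq (a + b) s)).
rewrite -[RHS]/(tclass (([:: (a *: u, v)] ++ tensor_scale_seq a s) ++
                        ([:: (b *: u, v)] ++ tensor_scale_seq b s))).
rewrite -!tensor_addE {}IH -tensor_addE scalerDl.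
have -> : tclass [:: (a *: u + b *: u, v)] =
  tensor_add (tclass [:: (a *: u, v)]) (tclass [:: (b *: u, v)]).
  by rewrite tensor_addE; apply/tclass_eq/tensor_eq_Dl.
rewrite !tensor_addA; congr tensor_add; rewrite -!tensor_addA; congr tensor_add.
exact: tensor_addC.
Qed.

Lemma tensor_scale_seq0 s : tensor_eq (tensor_scale_seq 0 s) [::].
Proof.
apply/tclass_eq; elim: s => [//|[u v] s IH].
rewrite -[LHS]/(tclass ([:: (0 *: u, v)] ++ tensor_scale_seq 0 s)).
rewrite -tensor_addE IH scale0r.
have -> : tclass [:: (0, v)] = tclass [::] by apply/tclass_eq/tensor_eq_0.
by rewrite tensor_addE.
Qed.

Lemma tensor_scale1 : left_id 1 tensor_scale.
Proof.
move=> x; rewrite -(treprK x) tensor_scaleE; congr tclass.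
by rewrite -[RHS]map_id; apply: eq_map => -[u v] /=; rewrite scale1r.
Qed.

Lemma tensor_scaleDl x a b :
  tensor_scale (a + b) x = tensor_add (tensor_scale a x) (tensor_scale b x).
Proof.
rewrite -(treprK x) !tensor_scaleE tensor_addE.
exact/tclass_eq/tensor_scale_seqDl.
Qed.

Lemma tensor_addN : left_inverse tensor_zero tensor_opp tensor_add.
Proof.
move=> x; rewrite -{2}(tensor_scale1 x) -tensor_scaleDl addNr -(treprK x).
by rewrite tensor_scaleE; apply/tclass_eq/tensor_scale_seq0.
Qed.

HB.instance Definition _ :=
  GRing.isZmodule.Build tensor tensor_addA tensor_addC tensor_add0 tensor_addN.

Lemma tensor_scaleA a b x :
  tensor_scale a (tensor_scale b x) = tensor_scale (a * b) x.
Proof.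
rewrite -(treprK x) !tensor_scaleE; congr tclass.
by rewrite /tensor_scale_seq -map_comp; apply: eq_map => p /=; rewrite scalerA.
Qed.

Lemma tensor_scaleDr : right_distributive tensor_scale +%R.
Proof.
move=> a x y; rewrite -(treprK x) -(treprK y).
rewrite -[(tclass _ + _)%R]/(tensor_add _ _) -[RHS]/(tensor_add _ _).
by rewrite tensor_addE !tensor_scaleE tensor_addE /tensor_scale_seq map_cat.
Qed.

HB.instance Definition _ :=
  GRing.Zmodule_isLmodule.Build k tensor
    tensor_scaleA tensor_scale1 tensor_scaleDr tensor_scaleDl.

Definition tens (u : U) (v : V) : tensor := tclass [:: (u, v)].

End TensorDef.

Arguments tensor {k} (U V)%_type.
Notation "U ⊗ V" := (tensor U V) (at level 40, left associativity) : type_scope.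
Notation "u ⊗ v" := (tens u v) (at level 40, left associativity) : ring_scope.

Definition is_bilinear (k : fieldType) (U V W : lmodType k) (f : U -> V -> W) :=
  (forall v, linear (f^~ v)) /\ (forall u, linear (f u)).

(* [tlift f t] is the sum of [f u v] over a representation of [t] as a sum   *)
(* of pure tensors [u ⊗ v]. It is meaningful for bilinear [f] only: it is    *)
(* then the value at [t] of the linear map induced by [f].                   *)
Definition tlift (k : fieldType) (U V W : lmodType k) (f : U -> V -> W)
  (t : U ⊗ V) : W := \sum_(p <- trepr t) f p.1 p.2.

Section TensorTheory.
Variables (k : fieldType) (U V : lmodType k).

Lemma tens_is_bilinear : is_bilinear (@tens k U V).
Proof.
split=> [v a u u'|u a v v'].
- have -> : tens (a *: u + u') v = tens (a *: u) v + tens u' v.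
    rewrite -[RHS]/(tensor_add _ _) tensor_addE.
    exact/tclass_eq/tensor_eq_Dl.
  by congr (_ + _); rewrite -[RHS]/(tensor_scale _ _) tensor_scaleE.
- have -> : tens u (a *: v + v') = tens u (a *: v) + tens u v'.
    rewrite -[RHS]/(tensor_add _ _) tensor_addE.
    exact/tclass_eq/tensor_eq_Dr.
  congr (_ + _); rewrite -[RHS]/(tensor_scale _ _) tensor_scaleE /=.
  exact/tclass_eq/tensor_eq_sym/tensor_eq_Z.
Qed.

Lemma tclassE (s : seq (U * V)) : tclass s = \sum_(p <- s) p.1 ⊗ p.2.
Proof.
elim: s => [|[u v] s IH]; first by rewrite big_nil.
by rewrite big_cons -IH -[RHS]/(tensor_add _ _) tensor_addE.
Qed.

Lemma tensE (t : U ⊗ V) : t = \sum_(p <- trepr t) p.1 ⊗ p.2.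
Proof. by rewrite -tclassE treprK. Qed.

Lemma tens_ind (P : U ⊗ V -> Prop) :
  (forall u v, P (u ⊗ v)) -> P 0 -> (forall s t, P s -> P t -> P (s + t)) ->
  forall t, P t.
Proof.
by move=> Pp P0 PD t; rewrite (tensE t); elim/big_ind: _ => // -[u v] _; apply: Pp.
Qed.

Variables (W : lmodType k).

Lemma eq_tlift (f g : U -> V -> W) t : f =2 g -> tlift f t = tlift g t.
Proof. by move=> fg; apply: eq_bigr => p _. Qed.

Section Lift.
Variables (f : U -> V -> W) (fbil : is_bilinear f).

Lemma bil_Dl u u' v : f (u + u') v = f u v + f u' v.
Proof. by have := fbil.1 v 1 u u'; rewrite /= !scale1r. Qed.
Lemma bil_Dr u v v' : f u (v + v') = f u v + f u v'.
Proof. by have := fbil.2 u 1 v v'; rewrite /= !scale1r. Qed.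
Lemma bil_0l v : f 0 v = 0.
Proof. by apply/(addrI (f 0 v)); rewrite -bil_Dl !addr0. Qed.
Lemma bil_0r u : f u 0 = 0.
Proof. by apply/(addrI (f u 0)); rewrite -bil_Dr !addr0. Qed.
Lemma bil_Zl a u v : f (a *: u) v = a *: f u v.
Proof. by have := fbil.1 v a u 0; rewrite /= bil_0l !addr0. Qed.
Lemma bil_Zr a u v : f u (a *: v) = a *: f u v.
Proof. by have := fbil.2 u a v 0; rewrite /= bil_0r !addr0. Qed.

Lemma tensor_eq_sum s t : tensor_eq s t ->
  \sum_(p <- s) f p.1 p.2 = \sum_(p <- t) f p.1 p.2.
Proof.
elim=> {s t} [//|s t _ ->//|s t r _ -> _ ->//|s s' t t' _ IH1 _ IH2|s t|u u' v
  |u v v'|a u v|v].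
- by rewrite !big_cat /= IH1 IH2.
- by rewrite !big_cat /= addrC.
- by rewrite !big_cons !big_nil /= !addr0 bil_Dl.
- by rewrite !big_cons !big_nil /= !addr0 bil_Dr.
- by rewrite !big_cons !big_nil /= !addr0 bil_Zl bil_Zr.
- by rewrite !big_cons !big_nil /= !addr0 bil_0l.
Qed.

Lemma tlift_class s : tlift f (tclass s) = \sum_(p <- s) f p.1 p.2.
Proof. exact/tensor_eq_sum/trepr_class. Qed.

Lemma tlift_tens u v : tlift f (u ⊗ v) = f u v.
Proof. by rewrite tlift_class big_seq1. Qed.

Lemma tlift_is_linear : linear (tlift f).
Proof.
move=> a s t; rewrite -{1}(treprK s) -{1}(treprK t).
rewrite -[(a *: _)]/(tensor_scale _ _) tensor_scaleE.
rewrite -[(_ + _)]/(tensor_add _ _) tensor_addE tlift_class big_cat /=.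
rewrite big_map scaler_sumr; congr (_ + _).
by apply: eq_bigr => p _ /=; rewrite bil_Zl.
Qed.

Lemma tliftD s t : tlift f (s + t) = tlift f s + tlift f t.
Proof. by have := tlift_is_linear 1 s t; rewrite !scale1r. Qed.
Lemma tlift0 : tlift f 0 = 0.
Proof. by rewrite -[0 in LHS]/(tclass [::]) tlift_class big_nil. Qed.
Lemma tliftZ a s : tlift f (a *: s) = a *: tlift f s.
Proof. by have := tlift_is_linear a s 0; rewrite tlift0 !addr0. Qed.
End Lift.

Lemma linear_tens_ext (f g : {linear (U ⊗ V)%type -> W}) :
  (forall u v, f (u ⊗ v) = g (u ⊗ v)) -> f =1 g.
Proof.
move=> fg; elim/tens_ind => [//||s t Ps Pt]; first by rewrite !linear0.
by rewrite !linearD Ps Pt.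
Qed.

End TensorTheory.

Section TensorMaps.
Variable k : fieldType.
Implicit Types A U V W : lmodType k.

Lemma linear_tlift A U V W (F : A -> U -> V -> W) t :
  (forall u v, linear (fun a => F a u v)) -> linear (fun a => tlift (F a) t).
Proof.
move=> Flin c a a'; rewrite scaler_sumr -big_split /=.
by apply: eq_bigr => p _; rewrite Flin.
Qed.

Lemma tens_linearl U V (v : V) : linear (fun u : U => u ⊗ v).
Proof. exact: (@tens_is_bilinear k U V).1. Qed.

Lemma tens_linearr U V (u : U) : linear (fun v : V => u ⊗ v).
Proof. exact: (@tens_is_bilinear k U V).2. Qed.

Lemma linear_compose U V W (f : V -> W) (g : U -> V) :
  linear f -> linear g -> linear (fun u => f (g u)).
Proof. by move=> fl gl a u v; rewrite gl fl. Qed.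

Lemma linear_of U V (f : {linear U -> V}) : linear f.
Proof. exact: linearP. Qed.

Section Map.
Variables (U V U' V' : lmodType k).
Variables (f : {linear U -> U'}) (g : {linear V -> V'}).
Definition tmap : U ⊗ V -> U' ⊗ V' := tlift (fun u v => f u ⊗ g v).

Lemma tmap_bilinear : is_bilinear (fun u v => f u ⊗ g v).
Proof.
split=> [v|u]; first exact: (linear_compose (@tens_linearl _ _ _)) (linear_of f).
exact: (linear_compose (@tens_linearr _ _ _)) (linear_of g).
Qed.

HB.instance Definition _ :=
  GRing.isLinear.Build k (U ⊗ V)%type (U' ⊗ V')%type *:%R tmap
    (tlift_is_linear tmap_bilinear).

Lemma tmap_tens u v : tmap (u ⊗ v) = f u ⊗ g v.
Proof. exact/tlift_tens/tmap_bilinear. Qed.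
End Map.

(* Sums over representations in iterated tensor products; as for [tlift],    *)
(* only meaningful for multilinear [f].                                      *)
Definition tlift3 U1 U2 U3 W (f : U1 -> U2 -> U3 -> W) (t : U1 ⊗ U2 ⊗ U3) : W :=
  tlift (fun s c => tlift (fun a b => f a b c) s) t.

Definition tlift4 U1 U2 U3 U4 W (f : U1 -> U2 -> U3 -> U4 -> W)
    (t : U1 ⊗ U2 ⊗ U3 ⊗ U4) : W :=
  tlift (fun s d => tlift3 (fun a b c => f a b c d) s) t.

Section MultilinearLift.
Variables (U1 U2 U3 U4 W : lmodType k).

Lemma tlift3_bilinear (f : U1 -> U2 -> U3 -> W) :
  (forall c, is_bilinear (fun a b => f a b c)) ->
  (forall a b, linear (f a b)) ->
  is_bilinear (fun s c => tlift (fun a b => f a b c) s).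
Proof.
move=> f12 f3; split=> [c|s]; first exact: tlift_is_linear (f12 c).
exact: linear_tlift f3.
Qed.

Lemma tlift3_tens (f : U1 -> U2 -> U3 -> W) a b c :
  (forall c, is_bilinear (fun a b => f a b c)) ->
  (forall a b, linear (f a b)) -> tlift3 f (a ⊗ b ⊗ c) = f a b c.
Proof.
move=> f12 f3; rewrite /tlift3 (tlift_tens (tlift3_bilinear f12 f3)).
exact: tlift_tens (f12 c) _ _.
Qed.

Lemma tlift4_bilinear (f : U1 -> U2 -> U3 -> U4 -> W) :
  (forall c d, is_bilinear (fun a b => f a b c d)) ->
  (forall a b d, linear (fun c => f a b c d)) ->
  (forall a b c, linear (f a b c)) ->
  is_bilinear (fun s d => tlift3 (fun a b c => f a b c d) s).
Proof.
move=> f12 f3 f4; split=> [d|s].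
  exact: tlift_is_linear (tlift3_bilinear (f12^~ d) (fun a b => f3 a b d)).
by apply: linear_tlift => u c; apply: linear_tlift => a b; apply: f4.
Qed.

Lemma tlift4_tens (f : U1 -> U2 -> U3 -> U4 -> W) a b c d :
  (forall c d, is_bilinear (fun a b => f a b c d)) ->
  (forall a b d, linear (fun c => f a b c d)) ->
  (forall a b c, linear (f a b c)) -> tlift4 f (a ⊗ b ⊗ c ⊗ d) = f a b c d.
Proof.
move=> f12 f3 f4; rewrite /tlift4 (tlift_tens (tlift4_bilinear f12 f3 f4)).
exact: (tlift3_tens _ _ _ (f12^~ d) (fun a b => f3 a b d)).
Qed.
End MultilinearLift.

Section Assoc.
Variables (U V W : lmodType k).
Definition tassoc : U ⊗ V ⊗ W -> U ⊗ (V ⊗ W) :=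
  tlift3 (fun u v w => u ⊗ (v ⊗ w)).

Lemma tassoc_bilinear1 (w : W) :
  is_bilinear (fun (u : U) (v : V) => u ⊗ (v ⊗ w)).
Proof.
split=> [v|u]; first exact: tens_linearl.
exact: (linear_compose (@tens_linearr _ _ _)) (@tens_linearl _ _ _).
Qed.

Lemma tassoc_bilinear2 : is_bilinear
  (fun (s : U ⊗ V) (w : W) => tlift (fun u v => u ⊗ (v ⊗ w)) s).
Proof.
split=> [w|s]; first exact/tlift_is_linear/tassoc_bilinear1.
apply: linear_tlift => u v.
exact: (linear_compose (@tens_linearr _ _ _)) (@tens_linearr _ _ _).
Qed.

HB.instance Definition _ :=
  GRing.isLinear.Build k (U ⊗ V ⊗ W)%type (U ⊗ (V ⊗ W))%type *:%R tassoc
    (tlift_is_linear tassoc_bilinear2).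

Lemma tassoc_tens u v w : tassoc (u ⊗ v ⊗ w) = u ⊗ (v ⊗ w).
Proof.
rewrite /tassoc /tlift3 (tlift_tens tassoc_bilinear2).
exact/tlift_tens/tassoc_bilinear1.
Qed.
End Assoc.

Section Swap.
Variables (U V : lmodType k).
Definition tswap : U ⊗ V -> V ⊗ U := tlift (fun u v => v ⊗ u).

Lemma tswap_bilinear : is_bilinear (fun (u : U) (v : V) => v ⊗ u).
Proof. by split=> [v|u]; [apply: tens_linearr | apply: tens_linearl]. Qed.

HB.instance Definition _ :=
  GRing.isLinear.Build k (U ⊗ V)%type (V ⊗ U)%type *:%R tswap
    (tlift_is_linear tswap_bilinear).

Lemma tswap_tens u v : tswap (u ⊗ v) = v ⊗ u.
Proof. exact/tlift_tens/tswap_bilinear. Qed.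
End Swap.

Section Middle.
Variables (U V U' V' : lmodType k).
Definition tmiddle : (U ⊗ V) ⊗ (U' ⊗ V') -> (U ⊗ U') ⊗ (V ⊗ V') :=
  tlift (fun s t => tlift (fun a b => tlift (fun c d =>
    (a ⊗ c) ⊗ (b ⊗ d)) t) s).

Lemma tmiddle_bilinear1 (a : U) (b : V) :
  is_bilinear (fun (c : U') (d : V') => (a ⊗ c) ⊗ (b ⊗ d)).
Proof.
split=> [d|c].
  exact: (linear_compose (@tens_linearl _ _ _)) (@tens_linearr _ _ _).
exact: (linear_compose (@tens_linearr _ _ _)) (@tens_linearr _ _ _).
Qed.

Lemma tmiddle_bilinear2 (t : U' ⊗ V') :
  is_bilinear (fun (a : U) (b : V) => tlift (fun c d => (a ⊗ c) ⊗ (b ⊗ d)) t).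
Proof.
split=> [b|a]; apply: linear_tlift => c d.
  exact: (linear_compose (@tens_linearl _ _ _)) (@tens_linearl _ _ _).
exact: (linear_compose (@tens_linearr _ _ _)) (@tens_linearl _ _ _).
Qed.

Lemma tmiddle_bilinear3 : is_bilinear (fun (s : U ⊗ V) (t : U' ⊗ V') =>
  tlift (fun a b => tlift (fun c d => (a ⊗ c) ⊗ (b ⊗ d)) t) s).
Proof.
split=> [t|s]; first exact/tlift_is_linear/tmiddle_bilinear2.
by apply: linear_tlift => a b; apply/tlift_is_linear/tmiddle_bilinear1.
Qed.

HB.instance Definition _ :=
  GRing.isLinear.Build k ((U ⊗ V) ⊗ (U' ⊗ V'))%type ((U ⊗ U') ⊗ (V ⊗ V'))%type *:%R
    tmiddle (tlift_is_linear tmiddle_bilinear3).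

Lemma tmiddle_tens a b c d :
  tmiddle ((a ⊗ b) ⊗ (c ⊗ d)) = (a ⊗ c) ⊗ (b ⊗ d).
Proof.
rewrite /tmiddle (tlift_tens tmiddle_bilinear3) (tlift_tens (tmiddle_bilinear2 _)).
exact/tlift_tens/tmiddle_bilinear1.
Qed.
End Middle.

End TensorMaps.

Arguments tmap {k U V U' V'} f g t.
Arguments tassoc {k U V W} t.
Arguments tswap {k U V} t.
Arguments tmiddle {k U V U' V'} t.

Section TensorExtra.
Variable k : fieldType.
Implicit Types U V W X : lmodType k.

Lemma tens0l U V (v : V) : (0 : U) ⊗ v = 0.
Proof. exact: (bil_0l (@tens_is_bilinear k U V)). Qed.
Lemma tens0r U V (u : U) : u ⊗ (0 : V) = 0.
Proof. exact: (bil_0r (@tens_is_bilinear k U V)). Qed.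
Lemma tensDl U V (u u' : U) (v : V) : (u + u') ⊗ v = u ⊗ v + u' ⊗ v.
Proof. exact: (bil_Dl (@tens_is_bilinear k U V)). Qed.
Lemma tensDr U V (u : U) (v v' : V) : u ⊗ (v + v') = u ⊗ v + u ⊗ v'.
Proof. exact: (bil_Dr (@tens_is_bilinear k U V)). Qed.
Lemma tensZl U V a (u : U) (v : V) : (a *: u) ⊗ v = a *: (u ⊗ v).
Proof. exact: (bil_Zl (@tens_is_bilinear k U V)). Qed.
Lemma tensZr U V a (u : U) (v : V) : u ⊗ (a *: v) = a *: (u ⊗ v).
Proof. exact: (bil_Zr (@tens_is_bilinear k U V)). Qed.

Lemma linear_tens3_ext U V W X (f g : {linear (U ⊗ V ⊗ W)%type -> X}) :
  (forall u v w, f (u ⊗ v ⊗ w) = g (u ⊗ v ⊗ w)) -> f =1 g.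
Proof.
move=> fg; apply: linear_tens_ext => s w.
elim/tens_ind: s => [//||s t IHs IHt]; first by rewrite tens0l !linear0.
by rewrite tensDl !linearD IHs IHt.
Qed.

Lemma scale_bilinearl U V (e : {linear U -> k^o}) :
  is_bilinear (fun (u : U) (v : V) => (e u : k) *: v).
Proof.
split=> [v a u u'|u a v v']; first by rewrite linearP scalerDl scalerA.
by rewrite scalerDr !scalerA mulrC.
Qed.

Lemma scale_bilinearr U V (e : {linear V -> k^o}) :
  is_bilinear (fun (u : U) (v : V) => (e v : k) *: u).
Proof.
split=> [v a u u'|u a v v']; last by rewrite linearP scalerDl scalerA.
by rewrite scalerDr !scalerA mulrC.
Qed.

Lemma tlift_tswap U V W (f : V -> U -> W) (t : U ⊗ V) :
  is_bilinear f -> tlift f (tswap t) = tlift (fun u v => f v u) t.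
Proof.
move=> fbil; have f'bil : is_bilinear (fun u v => f v u) by case: fbil; split.
elim/tens_ind: t => [u v||s t IHs IHt]; last 2 first.
- by rewrite linear0 !tlift0.
- by rewrite linearD !tliftD // IHs IHt.
by rewrite tswap_tens !tlift_tens.
Qed.

Lemma tmap_insert U X V W (f : {linear (U ⊗ X ⊗ V)%type -> W})
    (g : {linear (U ⊗ V)%type -> W}) (x : X) (s : U ⊗ U) (t : V ⊗ V) :
  (forall u v, g (u ⊗ v) = f (u ⊗ x ⊗ v)) ->
  tmap f f (tmiddle (tmiddle (s ⊗ (x ⊗ x)) ⊗ t)) = tmap g g (tmiddle (s ⊗ t)).
Proof.
move=> fg; elim/tens_ind: s => [u u'||s s' IHs IHs']; last 2 first.
- by rewrite !tens0l !linear0 !tens0l !linear0.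
- by rewrite !tensDl !linearD /= tensDl !linearD /= IHs IHs'.
elim/tens_ind: t => [v v'||t t' IHt IHt']; last 2 first.
- by rewrite !tens0r !linear0.
- by rewrite !tensDr !linearD /= IHt IHt'.
by rewrite !tmiddle_tens !tmap_tens !fg.
Qed.

End TensorExtra.

HB.mixin Record Lmodule_isCoalgebra (k : fieldType) C of GRing.Lmodule k C := {
  comul : {linear C -> (C ⊗ C)%type};
  counit : {linear C -> k^o};
  comulA : forall c : C,
    tassoc (tmap comul idfun (comul c)) = tmap idfun comul (comul c);
  counitl : forall c : C, tlift (fun a b => counit a *: b) (comul c) = c;
  counitr : forall c : C, tlift (fun a b => counit b *: a) (comul c) = c;
}.

#[short(type="coalgType")]
HB.structure Definition Coalgebra (k : fieldType) :=
  {C of Lmodule_isCoalgebra k C & GRing.Lmodule k C}.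

Definition is_coalg_map (k : fieldType) (C D : coalgType k)
    (f : {linear C -> D}) : Prop :=
  (forall c, comul (f c) = tmap f f (comul c)) /\
  (forall c, counit (f c) = counit c).

Definition grouplike (k : fieldType) (C : coalgType k) (x : C) : Prop :=
  comul x = x ⊗ x /\ counit x = 1.

(* c |-> c_1 ⊗ c_2 ⊗ c_3 ⊗ c_4 in Sweedler notation. *)
Definition comul4 (k : fieldType) (C : coalgType k) (c : C) : C ⊗ C ⊗ C ⊗ C :=
  tmap (tmap comul idfun) idfun (tmap comul idfun (comul c)).

Definition cop (k : fieldType) (C : coalgType k) : Type := C.

Section Cop.
Variables (k : fieldType) (C : coalgType k).

HB.instance Definition _ := GRing.Lmodule.copy (cop C) C.

Definition cop_comul : {linear C -> (C ⊗ C)%type} := tswap \o comul.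

Lemma cop_comulA (c : C) :
  tassoc (tmap cop_comul idfun (cop_comul c)) =
  tmap idfun cop_comul (cop_comul c).
Proof.
pose F : {linear (C ⊗ (C ⊗ C))%type -> (C ⊗ (C ⊗ C))%type} :=
  tassoc \o (tswap \o tmap idfun tswap).
pose G : {linear (C ⊗ C ⊗ C)%type -> (C ⊗ (C ⊗ C))%type} :=
  tswap \o tmap tswap idfun.
have L s : tassoc (tmap cop_comul idfun (tswap s)) = F (tmap idfun comul s).
  pose L1 : {linear (C ⊗ C)%type -> (C ⊗ (C ⊗ C))%type} :=
    tassoc \o (tmap cop_comul idfun \o tswap).
  pose L2 : {linear (C ⊗ C)%type -> (C ⊗ (C ⊗ C))%type} := F \o tmap idfun comul.
  apply: (linear_tens_ext (f := L1) (g := L2)) => u v.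
  by rewrite /L1 /L2 /F /= tswap_tens !tmap_tens /= tswap_tens.
have R s : tmap idfun cop_comul (tswap s) = G (tmap comul idfun s).
  pose L1 : {linear (C ⊗ C)%type -> (C ⊗ (C ⊗ C))%type} :=
    tmap idfun cop_comul \o tswap.
  pose L2 : {linear (C ⊗ C)%type -> (C ⊗ (C ⊗ C))%type} := G \o tmap comul idfun.
  apply: (linear_tens_ext (f := L1) (g := L2)) => u v.
  by rewrite /L1 /L2 /G /= tswap_tens !tmap_tens /= tswap_tens.
rewrite [LHS]L [RHS]R -comulA.
pose FA : {linear (C ⊗ C ⊗ C)%type -> (C ⊗ (C ⊗ C))%type} := F \o tassoc.
apply: (linear_tens3_ext (f := FA) (g := G)) => u v w.
by rewrite /FA /F /G /= tassoc_tens !tmap_tens /= !tswap_tens tassoc_tens.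
Qed.

Lemma cop_counitl (c : C) :
  tlift (fun a b => (counit a : k) *: b) (cop_comul c) = c.
Proof. by rewrite tlift_tswap ?counitr //; apply: scale_bilinearl. Qed.

Lemma cop_counitr (c : C) :
  tlift (fun a b => (counit b : k) *: a) (cop_comul c) = c.
Proof. by rewrite tlift_tswap ?counitl //; apply: scale_bilinearr. Qed.

HB.instance Definition _ :=
  Lmodule_isCoalgebra.Build k (cop C) cop_comulA cop_counitl cop_counitr.

End Cop.

Section TensorCoalgebra.
Variables (k : fieldType) (C D : coalgType k).

Definition tensor_comul (t : C ⊗ D) : (C ⊗ D) ⊗ (C ⊗ D) :=
  tmiddle (tmap comul comul t).

HB.instance Definition _ :=
  GRing.Linear.copy tensor_comul (tmiddle \o tmap comul comul).

Lemma counit_bilinear :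
  is_bilinear (fun (c : C) (d : D) => (counit c : k) * (counit d : k) : k^o).
Proof.
split=> [d a c c'|c a d d'] /=; rewrite linearP /=.
  by rewrite mulrDl -mulrA.
by rewrite mulrDr mulrCA.
Qed.

Definition tensor_counit (t : C ⊗ D) : k^o :=
  tlift (fun (c : C) (d : D) => (counit c : k) * (counit d : k) : k^o) t.

HB.instance Definition _ :=
  GRing.isLinear.Build k (C ⊗ D)%type k^o *:%R tensor_counit
    (tlift_is_linear counit_bilinear).

Lemma tensor_comul_tens c d :
  tensor_comul (c ⊗ d) = tmiddle (comul c ⊗ comul d).
Proof. by rewrite /tensor_comul tmap_tens. Qed.

Lemma tensor_counit_tens c d :
  tensor_counit (c ⊗ d) = (counit c : k) * (counit d : k).
Proof. exact/tlift_tens/counit_bilinear. Qed.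

Lemma tensor_comulA (x : C ⊗ D) :
  tassoc (tmap tensor_comul idfun (tensor_comul x)) =
  tmap idfun tensor_comul (tensor_comul x).
Proof.
elim/tens_ind: x => [c d||s t IHs IHt]; last 2 first.
- by rewrite !linear0.
- by rewrite !linearD /= IHs IHt.
have R (s : C ⊗ C) (t : D ⊗ D) :
    tmap idfun tensor_comul (tmiddle (s ⊗ t)) =
    tmap idfun tmiddle (tmiddle (tmap idfun comul s ⊗ tmap idfun comul t)).
  elim/tens_ind: s => [u v||s s' IHs IHs']; last 2 first.
  - by rewrite linear0 !tens0l !linear0.
  - by rewrite tensDl !linearD /= IHs IHs' tensDl !linearD /=.
  elim/tens_ind: t => [u' v'||t t' IHt IHt']; last 2 first.
  - by rewrite linear0 !tens0r !linear0.
  - by rewrite tensDr !linearD /= IHt IHt' tensDr !linearD /=.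
  by rewrite !tmap_tens !tmiddle_tens !tmap_tens /= tensor_comul_tens.
have Q (p : C ⊗ C) (q : D ⊗ D) v v' :
    tassoc (tmiddle (p ⊗ q) ⊗ (v ⊗ v')) =
    tmap idfun tmiddle (tmiddle (tassoc (p ⊗ v) ⊗ tassoc (q ⊗ v'))).
  elim/tens_ind: p => [a b||s s' IHs IHs']; last 2 first.
  - by rewrite !tens0l !linear0 !tens0l !linear0.
  - by rewrite !tensDl !linearD tensDl !linearD /= IHs IHs' tensDl !linearD /=.
  elim/tens_ind: q => [a' b'||t t' IHt IHt']; last 2 first.
  - by rewrite tens0r tens0l !linear0 tens0l tens0r !linear0.
  - rewrite tensDr tensDl !linearD tensDl !linearD /= IHt IHt'.
    by rewrite tensDr !linearD /=.
  by rewrite tmiddle_tens !tassoc_tens tmiddle_tens tmap_tens /= tmiddle_tens.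
have L (s : C ⊗ C) (t : D ⊗ D) :
    tassoc (tmap tensor_comul idfun (tmiddle (s ⊗ t))) =
    tmap idfun tmiddle (tmiddle
      (tassoc (tmap comul idfun s) ⊗ tassoc (tmap comul idfun t))).
  elim/tens_ind: s => [u v||s s' IHs IHs']; last 2 first.
  - by rewrite !linear0 !tens0l !linear0.
  - by rewrite tensDl !linearD /= IHs IHs' tensDl !linearD /=.
  elim/tens_ind: t => [u' v'||t t' IHt IHt']; last 2 first.
  - by rewrite !linear0 !tens0r !linear0.
  - by rewrite tensDr !linearD /= IHt IHt' tensDr !linearD /=.
  by rewrite tmiddle_tens !tmap_tens /= tensor_comul_tens Q.
by rewrite tensor_comul_tens L R !comulA.
Qed.

Lemma tensor_counitl (x : C ⊗ D) :
  tlift (fun a b => (tensor_counit a : k) *: b) (tensor_comul x) = x.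
Proof.
pose bil U := @scale_bilinearl k U.
elim/tens_ind: x => [c d||s t IHs IHt]; last 2 first.
- by rewrite linear0 tlift0 //; apply: bil.
- by rewrite linearD /= tliftD ?IHs ?IHt //; apply: bil.
rewrite tensor_comul_tens -[in RHS](counitl c) -[in RHS](counitl d).
move: (comul c) (comul d) => s t.
have bt := bil _ (C ⊗ D)%type tensor_counit.
have bc := bil _ C (@counit k C); have bd := bil _ D (@counit k D).
elim/tens_ind: s => [u v||s s' IHs IHs']; last 2 first.
- by rewrite !tens0l linear0 !tlift0 // tens0l.
- by rewrite tensDl !linearD /= !tliftD // IHs IHs' tensDl.
elim/tens_ind: t => [u' v'||t t' IHt IHt']; last 2 first.
- by rewrite !tens0r linear0 !tlift0 // tens0r.
- by rewrite tensDr !linearD /= !tliftD // IHt IHt' tensDr.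
rewrite tmiddle_tens !tlift_tens // tensor_counit_tens tensZl tensZr.
by rewrite scalerA.
Qed.

Lemma tensor_counitr (x : C ⊗ D) :
  tlift (fun a b => (tensor_counit b : k) *: a) (tensor_comul x) = x.
Proof.
pose bil U := @scale_bilinearr k U.
elim/tens_ind: x => [c d||s t IHs IHt]; last 2 first.
- by rewrite linear0 tlift0 //; apply: bil.
- by rewrite linearD /= tliftD ?IHs ?IHt //; apply: bil.
rewrite tensor_comul_tens -[in RHS](counitr c) -[in RHS](counitr d).
move: (comul c) (comul d) => s t.
have bt := bil (C ⊗ D)%type _ tensor_counit.
have bc := bil C _ (@counit k C); have bd := bil D _ (@counit k D).
elim/tens_ind: s => [u v||s s' IHs IHs']; last 2 first.
- by rewrite !tens0l linear0 !tlift0 // tens0l.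
- by rewrite tensDl !linearD /= !tliftD // IHs IHs' tensDl.
elim/tens_ind: t => [u' v'||t t' IHt IHt']; last 2 first.
- by rewrite !tens0r linear0 !tlift0 // tens0r.
- by rewrite tensDr !linearD /= !tliftD // IHt IHt' tensDr.
rewrite tmiddle_tens !tlift_tens // tensor_counit_tens tensZl tensZr.
by rewrite scalerA.
Qed.

HB.instance Definition _ :=
  Lmodule_isCoalgebra.Build k (C ⊗ D)%type
    tensor_comulA tensor_counitl tensor_counitr.

End TensorCoalgebra.

HB.mixin Record Coalgebra_isHopfHeap (k : fieldType) C of Coalgebra k C := {
  bracket : {linear (C ⊗ cop C ⊗ C)%type -> C};
  bracket_coalg : is_coalg_map bracket;
  bracketA : forall a b c d h : C,
    bracket (bracket (a ⊗ (b : cop C) ⊗ c) ⊗ (d : cop C) ⊗ h) =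
    bracket (a ⊗ (b : cop C) ⊗ bracket (c ⊗ (d : cop C) ⊗ h));
  bracketl : forall a c : C,
    tlift (fun c1 c2 => bracket (c1 ⊗ (c2 : cop C) ⊗ a)) (comul c) =
    (counit c : k) *: a;
  bracketr : forall a c : C,
    tlift (fun c1 c2 => bracket (a ⊗ (c1 : cop C) ⊗ c2)) (comul c) =
    (counit c : k) *: a;
}.

#[short(type="hopfHeapType")]
HB.structure Definition HopfHeap (k : fieldType) :=
  {C of Coalgebra_isHopfHeap k C & Coalgebra k C}.

Notation "⟦ a , b , c ⟧" := (bracket (a ⊗ (b : cop _) ⊗ c))
  (at level 0, a, b, c at level 99, format "⟦ a ,  b ,  c ⟧") : ring_scope.

HB.mixin Record HopfHeap_isCommutative (k : fieldType) C of HopfHeap k C := {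
  bracketC : forall x y z : C, ⟦x, y, z⟧ = ⟦z, y, x⟧;
}.

#[short(type="comHopfHeapType")]
HB.structure Definition ComHopfHeap (k : fieldType) :=
  {C of HopfHeap_isCommutative k C & HopfHeap k C}.

Section MulMap.
Variables (k : fieldType) (A : algType k).

Lemma mul_bilinear : is_bilinear (@GRing.mul A).
Proof.
split=> [v a u u'|u a v v']; first by rewrite mulrDl scalerAl.
by rewrite mulrDr scalerAr.
Qed.

Definition mulmap (t : A ⊗ A) : A := tlift *%R t.

HB.instance Definition _ :=
  GRing.isLinear.Build k (A ⊗ A)%type A *:%R mulmap
    (tlift_is_linear mul_bilinear).

Lemma mulmap_tens a b : mulmap (a ⊗ b) = a * b.
Proof. exact/tlift_tens/mul_bilinear. Qed.
End MulMap.

HB.mixin Record Algebra_isHopf (k : fieldType) H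
    of GRing.Algebra k H & Coalgebra k H := {
  one_grouplike : grouplike (1 : H);
  mulmap_coalg : is_coalg_map (@mulmap k H : {linear (H ⊗ H)%type -> H});
  antipode : {linear H -> H};
  antipodel : forall a : H,
    tlift (fun a1 a2 => antipode a1 * a2) (comul a) = (counit a : k) *: 1;
  antipoder : forall a : H,
    tlift (fun a1 a2 => a1 * antipode a2) (comul a) = (counit a : k) *: 1;
}.

#[short(type="hopfAlgType")]
HB.structure Definition HopfAlgebra (k : fieldType) :=
  {H of Algebra_isHopf k H & GRing.Algebra k H & Coalgebra k H}.

#[short(type="comHopfAlgType")]
HB.structure Definition ComHopfAlgebra (k : fieldType) :=
  {H of HopfAlgebra k H & GRing.ComAlgebra k H}.

(* H_x(C) is the coalgebra C; x and the proof that it is group-like are      *)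
(* phantom arguments, from which the Hopf algebra structure is inferred.     *)
Definition heap_hopf (k : fieldType) (C : hopfHeapType k) (x : C)
  (gx : grouplike x) : Type := C.

Section HeapHopf.
Variables (k : fieldType) (C : hopfHeapType k) (x : C) (gx : grouplike x).

Local Notation H := (heap_hopf gx).

HB.instance Definition _ := Coalgebra.copy H C.

Definition heap_mul (a b : H) : H := ⟦a : C, x, b : C⟧.

Definition heap_antipode (a : H) : H := ⟦x, a : C, x⟧.

Lemma bracket_lin1 (b c : C) : linear (fun a : C => ⟦a, b, c⟧).
Proof.
by move=> s a a'; rewrite !(tensDl, tensZl) linearP.
Qed.

Lemma bracket_lin2 (a c : C) : linear (fun b : C => ⟦a, b, c⟧).
Proof.
by move=> s b b'; rewrite tensDr tensZr tensDl tensZl linearP.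
Qed.

Lemma bracket_lin3 (a b : C) : linear (fun c : C => ⟦a, b, c⟧).
Proof.
by move=> s c c'; rewrite tensDr tensZr linearP.
Qed.

Lemma bracket_bilinear12 (c : C) : is_bilinear (fun a b : C => ⟦a, b, c⟧).
Proof. by split=> [b|a]; [apply: bracket_lin1 | apply: bracket_lin2]. Qed.

Lemma bracket_bilinear13 (b : C) : is_bilinear (fun a c : C => ⟦a, b, c⟧).
Proof. by split=> [c|a]; [apply: bracket_lin1 | apply: bracket_lin3]. Qed.

Lemma bracket_bilinear23 (a : C) : is_bilinear (fun b c : C => ⟦a, b, c⟧).
Proof. by split=> [c|b]; [apply: bracket_lin2 | apply: bracket_lin3]. Qed.

Lemma bracketxx (a : C) : ⟦x, x, a⟧ = a.
Proof.
have := bracketl a x; rewrite gx.1 gx.2 scale1r.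
by rewrite (tlift_tens (bracket_bilinear12 a)).
Qed.

Lemma bracket_xx (a : C) : ⟦a, x, x⟧ = a.
Proof.
have := bracketr a x; rewrite gx.1 gx.2 scale1r.
by rewrite (tlift_tens (bracket_bilinear23 a)).
Qed.

Lemma heap_mulA : associative heap_mul.
Proof. by move=> a b c; rewrite /heap_mul bracketA. Qed.

Lemma heap_mul1 : left_id (x : H) heap_mul.
Proof. exact: bracketxx. Qed.

Lemma heap_mulr1 : right_id (x : H) heap_mul.
Proof. exact: bracket_xx. Qed.

Lemma heap_mulDl : left_distributive heap_mul +%R.
Proof. by move=> a b c; apply: (bil_Dl (bracket_bilinear13 x)). Qed.

Lemma heap_mulDr : right_distributive heap_mul +%R.
Proof. by move=> a b c; apply: (bil_Dr (bracket_bilinear13 x)). Qed.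

Lemma heap_one_neq0 : (x : H) != 0.
Proof.
apply/eqP => x0; have := gx.2; rewrite [x]x0 linear0 => /eqP.
by rewrite eq_sym oner_eq0.
Qed.

HB.instance Definition _ :=
  GRing.Zmodule_isNzRing.Build H heap_mulA heap_mul1 heap_mulr1
    heap_mulDl heap_mulDr heap_one_neq0.

Lemma heap_scaleAl (s : k) (a b : H) : s *: (a * b) = s *: a * b.
Proof. by symmetry; apply: (bil_Zl (bracket_bilinear13 x)). Qed.

HB.instance Definition _ := GRing.Lmodule_isLalgebra.Build k H heap_scaleAl.

Lemma heap_scaleAr (s : k) (a b : H) : s *: (a * b) = a * (s *: b).
Proof. by symmetry; apply: (bil_Zr (bracket_bilinear13 x)). Qed.

HB.instance Definition _ := GRing.Lalgebra_isAlgebra.Build k H heap_scaleAr.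

Lemma heap_antipode_linear : linear heap_antipode.
Proof. exact: bracket_lin2. Qed.

HB.instance Definition _ :=
  GRing.isLinear.Build k H H *:%R heap_antipode heap_antipode_linear.

Lemma heap_mulmap_coalg :
  is_coalg_map (@mulmap k H : {linear (H ⊗ H)%type -> H}).
Proof.
split=> [t|t]; (elim/tens_ind: t => [a b||s t IHs IHt]; last 2 first;
  [by rewrite !linear0|by rewrite !linearD /= IHs IHt|]).
- rewrite /= mulmap_tens [LHS](bracket_coalg.1 ((a : C) ⊗ (x : cop C) ⊗ (b : C))).
  have cx : comul (x : cop C) = (x : cop C) ⊗ (x : cop C).
    by rewrite -[LHS]/(tswap (comul x)) gx.1 tswap_tens.
  rewrite -[X in tmap _ _ X]/(tensor_comul ((a : C) ⊗ (x : cop C) ⊗ (b : C))).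
  rewrite -[comul ((a : H) ⊗ (b : H))]/(tensor_comul ((a : C) ⊗ (b : C))).
  rewrite !tensor_comul_tens.
  rewrite -[comul ((a : C) ⊗ (x : cop C))]
    /(tensor_comul ((a : C) ⊗ (x : cop C))).
  rewrite tensor_comul_tens cx.
  have E (u v : H) : mulmap (u ⊗ v) = bracket ((u : C) ⊗ (x : cop C) ⊗ (v : C)).
    by rewrite mulmap_tens.
  have R := @tmap_insert k H (cop C) H H
    (@bracket k C : {linear ((H : lmodType k) ⊗ cop C ⊗ H)%type -> (H : lmodType k)})
    (@mulmap k H : {linear (H ⊗ H)%type -> H}) x (@comul k C a) (@comul k C b) E.
  exact: R.
rewrite /= mulmap_tens [LHS](bracket_coalg.2 ((a : C) ⊗ (x : cop C) ⊗ (b : C))).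
rewrite -[LHS]/(tensor_counit ((a : C) ⊗ (x : cop C) ⊗ (b : C))).
rewrite -[RHS]/(tensor_counit ((a : C) ⊗ (b : C))) !tensor_counit_tens.
rewrite -[counit ((a : C) ⊗ (x : cop C))]
  /(tensor_counit ((a : C) ⊗ (x : cop C))) tensor_counit_tens.
have -> : counit (x : cop C) = 1 by exact: gx.2.
by rewrite mulr1.
Qed.

Lemma heap_antipodel (a : H) :
  tlift (fun a1 a2 => heap_antipode a1 * a2) (comul a) = (counit a : k) *: 1.
Proof.
rewrite -[RHS](bracketr (x : C) (a : C)); apply: eq_tlift => a1 a2.
by rewrite -[LHS]/⟦⟦x, a1, x⟧, x, a2⟧ bracketA bracketxx.
Qed.

Lemma heap_antipoder (a : H) :
  tlift (fun a1 a2 => a1 * heap_antipode a2) (comul a) = (counit a : k) *: 1.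
Proof.
rewrite -[RHS](bracketl (x : C) (a : C)); apply: eq_tlift => a1 a2.
by rewrite -[LHS]/⟦a1, x, ⟦x, a2, x⟧⟧ -bracketA bracket_xx.
Qed.

HB.instance Definition _ :=
  Algebra_isHopf.Build k H gx heap_mulmap_coalg heap_antipodel heap_antipoder.

Lemma heap_oneE : (1 : H) = x.
Proof. by []. Qed.

Lemma heap_mulE (a b : H) : a * b = ⟦a : C, x, b : C⟧.
Proof. by []. Qed.

Lemma heap_antipodeE (a : H) : antipode a = ⟦x, a : C, x⟧.
Proof. by []. Qed.

End HeapHopf.

Section ComHeapHopf.
Variables (k : fieldType) (C : comHopfHeapType k) (x : C) (gx : grouplike x).

Lemma heap_mulC : commutative (@GRing.mul (heap_hopf gx)).
Proof. by move=> a b; apply: bracketC. Qed.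

HB.instance Definition _ :=
  GRing.PzRing_hasCommutativeMul.Build (heap_hopf gx) heap_mulC.
End ComHeapHopf.

(* In the formulas below the Sweedler components of B(a) are written         *)
(* b1, b2, b3, b4.                                                           *)
Definition rota_baxter_operator (k : fieldType) (C : hopfHeapType k)
    (B : {linear C -> C}) : Prop :=
  (forall a b c : C, B ⟦a, b, c⟧ = ⟦B a, B b, B c⟧) /\
  (forall a : C, tmap B B (comul a) =
    tlift4 (fun b1 b2 b3 b4 => ⟦b1, B b4, B b2⟧ ⊗ b3) (comul4 (B a))).

Definition rota_baxter_cooperator (k : fieldType) (H : comHopfAlgType k)
    (B : {linear H -> H}) : Prop :=
  GRing.monoid_morphism B /\
  (forall a : H, tmap B B (comul a) =
    tlift4 (fun b1 b2 b3 b4 => (b1 * B (b2 * antipode b4)) ⊗ b3)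
      (comul4 (B a))).

(* Main.v *)
From HB Require Import structures.
From mathcomp Require Import all_boot all_order all_algebra.
Require Import Defs.

(* In H_x(C) one has b S(c) = [b, c, x], so B(b S(c)) = [B(b), B(c), x];     *)
(* commutativity turns this into [x, B(c), B(b)], and multiplying by a on    *)
(* the left absorbs x and gives [a, B(c), B(b)]. The two Rota-Baxter         *)
(* identities thus agree termwise.                                           *)

Local Open Scope ring_scope.

Lemma heap_mul_rota_baxter (k : fieldType) (C : comHopfHeapType k)
    (B : {linear C -> C}) (x : C) (gx : grouplike x) (a b c : heap_hopf gx) :
  (forall u v w : C, B ⟦u, v, w⟧ = ⟦B u, B v, B w⟧) -> B x = x ->
  a * (B (b * antipode c) : heap_hopf gx) = ⟦a : C, B c, B b⟧.
Proof.
move=> Bbracket Bx; rewrite !heap_mulE heap_antipodeE -bracketA (bracket_xx gx).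
by rewrite Bbracket Bx (bracketC (B b)) -bracketA (bracket_xx gx).
Qed.

Local Close Scope ring_scope.

Theorem proposition5p7 (k : fieldType) (C : comHopfHeapType k)
    (B : {linear C -> C}) (hB : rota_baxter_operator B)
    (x : C) (gx : grouplike x) (hx : B x = x) :
  rota_baxter_cooperator (B : {linear heap_hopf gx -> heap_hopf gx}).
Proof.
case: hB => Bbracket Bcomul; split=> [|a].
  (* The unit is [x] and the product [[a, x, b]], so a bracket-preserving map that fixes [x] is a
     unital algebra map. *)
  by split=> // a b; rewrite !heap_mulE Bbracket hx.
(* As the coalgebra of [heap_hopf gx] is [C] itself, both sides are sums over the same
   representatives of [comul4 (B a)]. Comparing summands suffices; their right factors [b3]
   coincide. *)
rewrite [LHS]Bcomul; do 3![apply: eq_tlift => ? ?]; congr tens.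
by rewrite heap_mul_rota_baxter.
Qed.
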